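(* There is a reduction from an instance of \textsc{OraclePureCircuit} (with node set $V$ and oracle $\mathcal{L}$) to \textsc{SmoothBrouwer} with approximation $\varepsilon=\tfrac1{12}$, such that: (1) the resulting function is $F:[0,1]^d\to[0,1]^d$ with $F\in\mathcal{C}^\infty$, where $d=|V|$; (2) any query to $F$ or to its Jacobian $J_F$ can be simulated with at most $d=|V|$ queries to $\mathcal{L}$; (3) from any solution of the \textsc{SmoothBrouwer} instance (i.e., any $z\in[0,1]^d$ with $\|F(z)-z\|_\infty\le\tfrac1{12}$) one can efficiently recover a solution of the \textsc{OraclePureCircuit} instance; (4) $F$ is $(e^{12}d)$-Lipschitz and $(12e^{24}d^2)$-smooth, and $|\partial_{z_j}F_i(z)|\le e^{12}$ for all $i,j\in[d]$ and $z\in[0,1]^d$.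
   Context: \textsc{OraclePureCircuit}: An instance is given by a natural number $N$, a finite set of nodes $V$ (with $N\le|V|$), three sets of gates $\mathcal{G}_{\textsc{Nor}}$, $\mathcal{G}_{\textsc{Purify}}$, $\mathcal{G}_{\textsc{Oracle}}$, and oracle access to $\mathcal{L}:\{0,1\}^N\to\{0,1\}$. Each gate is a tuple of distinct nodes: $(u,v,w)\in\mathcal{G}_{\textsc{Nor}}$ has inputs $u,v$, output $w$; $(u,v,w)\in\mathcal{G}_{\textsc{Purify}}$ has input $u$, outputs $v,w$; $(u_1,\dots,u_N,v)\in\mathcal{G}_{\textsc{Oracle}}$ has inputs $u_1,\dots,u_N$, output $v$. Each node is the output of exactly one gate. A solution is $b:V\to\{0,1,\bot\}$ such that: for $(u,v,w)\in\mathcal{G}_{\textsc{Nor}}$, $b(u)=b(v)=0\implies b(w)=1$ and ($b(u)=1$ or $b(v)=1$)$\implies b(w)=0$; for $(u,v,w)\in\mathcal{G}_{\textsc{Purify}}$, $\{b(v),b(w)\}\cap\{0,1\}\neq\emptyset$ and $b(u)\in\{0,1\}\implies b(v)=b(w)=b(u)$; for $(u_1,\dots,u_N,v)\in\mathcal{G}_{\textsc{Oracle}}$, $(b(u_1),\dots,b(u_N))\in\{0,1\}^N\implies b(v)=\mathcal{L}(b(u_1),\dots,b(u_N))$. \textsc{SmoothBrouwer}: given $\varepsilon>0$ and oracles for a Lipschitz $\mathcal{C}^1$ function $F:[0,1]^d\to[0,1]^d$ and its Jacobian $J_F:[0,1]^d\to\mathbb{R}^{d\times d}$, find $z\in[0,1]^d$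 with $\|F(z)-z\|_\infty\le\varepsilon$. $F$ is $G$-Lipschitz if $\|F(x)-F(x')\|\le G\|x-x'\|$ and $L$-smooth if $\|J_F(x)-J_F(x')\|_2\le L\|x-x'\|_2$ (Euclidean norm for vectors, spectral norm for matrices). *)

(* Defs.v *)
From mathcomp Require Import all_boot all_order all_algebra.
From mathcomp Require Import all_classical all_reals all_analysis.
Set Implicit Arguments.
Unset Strict Implicit.
Unset Printing Implicit Defensive.
Import Order.TTheory GRing.Theory Num.Theory numFieldNormedType.Exports.
Local Open Scope classical_set_scope.
Local Open Scope ring_scope.

(* ** OraclePureCircuit *)

(* A Nor gate is (u, v, w) with output w; a Purify gate is (u, v, w) with
   outputs v and w; an Oracle gate is ((u_1, ..., u_N), v) with output v. *)
Record circuit (N : nat) (V : finType) := Circuit {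
  nor_gates : {set V * V * V};
  purify_gates : {set V * V * V};
  oracle_gates : {set N.-tuple V * V};
  circuit_arity : (N <= #|V|)%N;
  nor_uniq : forall u v w, (u, v, w) \in nor_gates -> uniq [:: u; v; w];
  purify_uniq : forall u v w, (u, v, w) \in purify_gates -> uniq [:: u; v; w];
  oracle_uniq : forall (us : N.-tuple V) v,
    (us, v) \in oracle_gates -> uniq (v :: us);
  output_once : forall x : V,
    (#|[set g in nor_gates | x == g.2]|
     + #|[set g in purify_gates | (x == g.1.2) || (x == g.2)]|
     + #|[set g in oracle_gates | x == g.2]| = 1)%N
}.

(* The values {0, 1, bot} are encoded as Some false, Some true and None. *)
Definition opc_solution N V (C : circuit N V) (L : N.-tuple bool -> bool)
    (b : V -> option bool) : Prop :=
  [/\ forall u v w, (u, v, w) \in nor_gates C ->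
        (b u = Some false /\ b v = Some false -> b w = Some true) /\
        (b u = Some true \/ b v = Some true -> b w = Some false),
      forall u v w, (u, v, w) \in purify_gates C ->
        (b v <> None \/ b w <> None) /\
        (forall c : bool, b u = Some c -> b v = Some c /\ b w = Some c)
    & forall (us : N.-tuple V) v, (us, v) \in oracle_gates C ->
        forall x : N.-tuple bool,
        (forall i, b (tnth us i) = Some (tnth x i)) -> b v = Some (L x)].

(* ** SmoothBrouwer *)

Section SmoothBrouwer.
Variables (R : realType) (d : nat).

Local Notation point := 'cV[R]_d.

Definition cube : set point := [set z | forall i, 0 <= z i 0 <= 1].

Definition l2norm (x : point) : R := Num.sqrt (\sum_i x i 0 ^+ 2).

Definition spectral_norm (A : 'M[R]_d) : R :=
  sup [set l2norm (A *m x) | x in [set x : point | l2norm x <= 1]].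

Definition lipschitz_cube (G : R) (F : point -> point) : Prop :=
  forall x y, cube x -> cube y -> l2norm (F x - F y) <= G * l2norm (x - y).

Definition smooth_cube (K : R) (J : point -> 'M[R]_d) : Prop :=
  forall x y, cube x -> cube y ->
    spectral_norm (J x - J y) <= K * l2norm (x - y).

(* The derivative is taken relative to the cube, so that it also makes sense
   on the boundary; it is unique there because the cube is convex with
   nonempty interior.  J z i j is the partial derivative of F_i along z_j. *)
Definition is_jacobian (F : point -> point) (J : point -> 'M[R]_d) : Prop :=
  forall z, cube z -> forall e : R, 0 < e ->
    \forall x \near within cube (nbhs z),
      `|F x - F z - J z *m (x - z)| <= e * `|x - z|.

Fixpoint Ck (k : nat) (U : set point) (f : point -> R) : Prop :=
  (forall x, U x -> {for x, continuous f}) /\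
  if k is k'.+1 then
    forall j : 'I_d, (forall x, U x -> derivable f x (delta_mx j 0)) /\
                     Ck k' U (fun x => 'D_(delta_mx j 0) f x)
  else True.

(* Functions on the closed cube are of class C^k (resp. C^oo) when they have
   an extension of that class to an open neighbourhood of the cube. *)
Definition Ck_cube (k : nat) (F : point -> point) : Prop :=
  exists (U : set point) (G : point -> point),
    [/\ open U, cube `<=` U, {in cube, G =1 F}
      & forall i, Ck k U (fun x => G x i 0)].

Definition Coo_cube (F : point -> point) : Prop :=
  exists (U : set point) (G : point -> point),
    [/\ open U, cube `<=` U, {in cube, G =1 F}
      & forall k i, Ck k U (fun x => G x i 0)].

(* Only the values of sb_F and sb_J on the cube are meaningful. *)
Record smooth_brouwer := SmoothBrouwer {
  sb_eps : R;
  sb_F : point -> point;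
  sb_J : point -> 'M[R]_d;
  sb_eps_gt0 : 0 < sb_eps;
  sb_maps : forall z, cube z -> cube (sb_F z);
  sb_lipschitz : exists G, lipschitz_cube G sb_F;
  sb_C1 : Ck_cube 1 sb_F;
  sb_jacobian : is_jacobian sb_F sb_J
}.

(* The norm of 'cV[R]_d in the library is the sup norm. *)
Definition sb_solution (I : smooth_brouwer) (z : point) : Prop :=
  cube z /\ `|sb_F I z - z| <= sb_eps I.

End SmoothBrouwer.

(* ** Simulation of a query by queries to L *)

(* An adaptive procedure that queries an unknown L : {0,1}^N -> {0,1}. *)
Inductive oracle_proc (N : nat) (X : Type) : Type :=
| Answer of X
| Query of N.-tuple bool & (bool -> oracle_proc N X).

Fixpoint run N X (L : N.-tuple bool -> bool) (t : oracle_proc N X) : X :=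
  match t with
  | Answer a => a
  | Query x k => run L (k (L x))
  end.

Fixpoint num_queries N X (L : N.-tuple bool -> bool) (t : oracle_proc N X)
    : nat :=
  match t with
  | Answer _ => 0
  | Query x k => (num_queries L (k (L x))).+1
  end.

(* The procedures depend on the circuit but not on L; the node v of the
   circuit corresponds to the coordinate enum_rank v. *)
Record simulator (R : realType) N V (C : circuit N V) := Simulator {
  sim_F : 'cV[R]_#|V| -> oracle_proc N 'cV[R]_#|V|;
  sim_J : 'cV[R]_#|V| -> oracle_proc N 'M[R]_#|V|
}.

(* ** Efficient recovery *)

(* Programs of a unit-cost real RAM without access to L.  There are registers
   and an indirectly addressed memory, both for naturals (N) and for reals (R).
   Naturals cannot be multiplied, so that polynomially many steps only produce
   naturals of polynomial bit length. *)
Inductive instr : Type :=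
| NConst of nat & nat
| NAdd of nat & nat & nat
| NSub of nat & nat & nat
| NLoad of nat & nat
| NStore of nat & nat
| NJumpLe of nat & nat & nat
| RConst of nat & rat
| RAdd of nat & nat & nat
| RSub of nat & nat & nat
| RMul of nat & nat & nat
| RDiv of nat & nat & nat
| RLoad of nat & nat
| RStore of nat & nat
| RJumpLe of nat & nat & nat.

Definition program := seq instr.

Record state (R : realType) := State {
  pc : nat;
  nreg : nat -> nat;
  nmem : nat -> nat;
  rreg : nat -> R;
  rmem : nat -> R
}.

Section Machine.
Variable R : realType.

Definition exec (c : instr) (s : state R) : state R :=
  let: State p n m r q := s in
  match c with
  | NConst i a => State p.+1 [eta n with i |-> a] m r q
  | NAdd i j k => State p.+1 [eta n with i |-> (n j + n k)%N] m r q
  | NSub i j k => State p.+1 [eta n with i |-> (n j - n k)%N] m r q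
  | NLoad i j => State p.+1 [eta n with i |-> m (n j)] m r q
  | NStore i j => State p.+1 n [eta m with n i |-> n j] r q
  | NJumpLe i j t => State (if (n i <= n j)%N then t else p.+1) n m r q
  | RConst i a => State p.+1 n m [eta r with i |-> ratr a] q
  | RAdd i j k => State p.+1 n m [eta r with i |-> r j + r k] q
  | RSub i j k => State p.+1 n m [eta r with i |-> r j - r k] q
  | RMul i j k => State p.+1 n m [eta r with i |-> r j * r k] q
  | RDiv i j k => State p.+1 n m [eta r with i |-> r j / r k] q
  | RLoad i j => State p.+1 n m [eta r with i |-> q (n j)] q
  | RStore i j => State p.+1 n m r [eta q with n i |-> r j]
  | RJumpLe i j t => State (if r i <= r j then t else p.+1) n m r q
  end.

Definition halted (P : program) (s : state R) : bool := (size P <= pc s)%N.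

Definition step (P : program) (s : state R) : state R :=
  if halted P s then s else exec (nth (NConst 0 0) P (pc s)) s.

End Machine.

Definition node_code (V : finType) (v : V) : nat := enum_rank v.

Definition encode N V (C : circuit N V) : seq nat :=
  [:: N; #|V|; #|nor_gates C|; #|purify_gates C|; #|oracle_gates C|]
  ++ flatten [seq [seq node_code x | x <- [:: g.1.1; g.1.2; g.2]]
             | g <- enum (nor_gates C)]
  ++ flatten [seq [seq node_code x | x <- [:: g.1.1; g.1.2; g.2]]
             | g <- enum (purify_gates C)]
  ++ flatten [seq [seq node_code x | x <- rcons (val g.1) g.2]
             | g <- enum (oracle_gates C)].

Definition init_state (R : realType) N V (C : circuit N V) (z : 'cV[R]_#|V|)
    : state R :=
  {| pc := 0;
     nreg := fun=> 0%N;
     nmem := fun a => nth 0%N (encode C) a;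
     rreg := fun=> 0;
     rmem := fun a => if insub a is Some i then z i 0 else 0 |}.

Definition output (R : realType) (V : finType) (s : state R) (v : V)
    : option bool :=
  match nmem s (node_code v) with
  | 0 => Some false
  | 1 => Some true
  | _ => None
  end.

(* On input (C, z), P halts within c * size ^ c steps with output b. *)
Definition recovers (R : realType) (P : program) (c : nat) N V
    (C : circuit N V) (z : 'cV[R]_#|V|) (b : V -> option bool) : Prop :=
  let s := iter (c * size (encode C) ^ c)%N (step P) (init_state C z) in
  halted P s /\ b = output s.

(* Main.v *)
Require Import Defs.
From mathcomp Require Import all_boot all_order all_algebra.
From mathcomp Require Import all_classical all_reals all_analysis.
From mathcomp Require Import ring lra zify.
Set Implicit Arguments.
Unset Strict Implicit.
Unset Printing Implicit Defensive.
Import Order.TTheory GRing.Theory Num.Theory numFieldNormedType.Exports.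
Local Open Scope classical_set_scope.
Local Open Scope ring_scope.

(* Round a coordinate to 0 below 1/12, to 1 above 11/12 and to bot in between.
   With smooth steps sigma, flat outside an interval of length 1/3, the gates
   become
     Nor:     F_w = low z_u * low z_v,
     Purify:  F_v = mid z_u,  F_w = high z_u,
     Oracle:  F_v = \sum_b L b * \prod_k (if b_k then high else low) z_(u_k),
   where low steps from 1 to 0 on [1/12, 5/12], mid from 0 to 1 on [1/6, 1/2] and
   high from 0 to 1 on [7/12, 11/12].  The sum has at most one term that does not
   vanish near a given point, so a value or a derivative of F_v costs one query,
   and its partial derivatives are bounded by those of sigma, independently of N.
   The bounds on the first and second partial derivatives give the Lipschitz
   constant, the smoothness constant and the Jacobian by the mean value theorem,
   applied to one coordinate at a time. *)


(** * Smooth functions of one real variable *)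

Section SmoothFunctions.
Local Open Scope classical_set_scope.
Variable R : realType.
Implicit Types (f g : R -> R) (x : R) (n : nat).

(** Peeling off the first derivative, rather than the last, lets the closure properties below go by
    induction on [n] with the functions generalized. *)
Fixpoint times_derivable n g : Prop :=
  if n is m.+1 then (forall x, derivable g x 1) /\ times_derivable m g^`()
  else True.

Definition smooth g := forall n, times_derivable n g.

Lemma times_derivable_is_derive n g g' :
    (forall x, is_derive x 1 g (g' x)) -> times_derivable n g' ->
  times_derivable n.+1 g.
Proof.
move=> gg' sg'; split=> [x|]; first by have [] := gg' x.
suff -> : g^`() = g' by [].
by apply/funext => x; rewrite derive1E; have [_ ->] := gg' x.
Qed.

Lemma times_derivableS n g : times_derivable n.+1 g -> times_derivable n g.
Proof. by elim: n g => [//|n IH] g [dg /IH]. Qed.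

Lemma times_derivable_is_derive1 n g x :
  times_derivable n.+1 g -> is_derive x 1 g (g^`() x).
Proof. by move=> [/(_ x) dg _]; rewrite derive1E; exact: DeriveDef. Qed.

Lemma smoothP g n x : smooth g -> is_derive x 1 g^`(n) (g^`(n.+1) x).
Proof.
move=> sg; move/(_ n.+1): sg; elim: n g => [|n IH] g sg.
  by rewrite derive1n1 derive1n0; exact: times_derivable_is_derive1 sg.
by rewrite !(derive1Sn g); apply: IH; case: sg.
Qed.

Lemma times_derivableD n f g : times_derivable n f -> times_derivable n g ->
  times_derivable n (fun x => f x + g x).
Proof.
elim: n f g => [//|n IH] f g sf sg.
apply: (@times_derivable_is_derive _ _ (fun x => derive1 f x + derive1 g x)).
  move=> x; have df := times_derivable_is_derive1 x sf.
  have dg := times_derivable_is_derive1 x sg.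
  exact: is_deriveD.
by apply: IH; [case: sf | case: sg].
Qed.

Lemma times_derivableM n f g :
  times_derivable n f -> times_derivable n g -> times_derivable n (f \* g).
Proof.
elim: n f g => [//|n IH] f g sf sg.
have h x : is_derive x 1 (f \* g) ((f \* g^`()) x + (g \* f^`()) x).
  have df := times_derivable_is_derive1 x sf.
  have dg := times_derivable_is_derive1 x sg.
  exact: is_deriveM.
apply: (times_derivable_is_derive h).
by apply: times_derivableD; apply: IH;
  [exact: times_derivableS | case: sg | exact: times_derivableS | case: sf].
Qed.

Lemma times_derivable_comp n f g :
  times_derivable n f -> times_derivable n g -> times_derivable n (f \o g).
Proof.
elim: n f g => [//|n IH] f g sf sg.
apply: (@times_derivable_is_derive _ _ ((derive1 f \o g) \* derive1 g)) => [x|].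
  have df := times_derivable_is_derive1 (g x) sf.
  have dg := times_derivable_is_derive1 x sg.
  exact: is_derive1_comp.
apply: times_derivableM; last by case: sg.
by apply: IH; [case: sf | exact: times_derivableS].
Qed.

Lemma smooth_comp f g : smooth f -> smooth g -> smooth (f \o g).
Proof. by move=> sf sg n; apply: times_derivable_comp. Qed.

Lemma smooth_cst (c : R) : smooth (fun=> c).
Proof.
move=> n; elim: n c => [//|n IH] c.
by apply: (@times_derivable_is_derive _ _ (fun=> 0)) => // x; exact: is_derive_cst.
Qed.

Lemma is_derive_affine (a b x : R) : is_derive x 1 (fun t => a * t + b) a.
Proof.
have -> : (fun t => a * t + b) = (a \*: id) + cst b by [].
by apply: is_derive_eq; rewrite addr0 /GRing.scale /= mulr1.
Qed.

Lemma smooth_affine (a b : R) : smooth (fun t => a * t + b).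
Proof.
case=> [//|n]; apply: (@times_derivable_is_derive _ _ (fun=> a)).
  by move=> x; exact: is_derive_affine.
exact: smooth_cst.
Qed.

Lemma derive1n_affine f (a b : R) n : smooth f ->
  (fun t => f (a * t + b))^`(n) = fun t => a ^+ n * derive1n n f (a * t + b).
Proof.
move=> sf; elim: n => [|n IH].
  by rewrite !derive1n0; apply/funext => t; rewrite mul1r.
rewrite derive1nS IH; apply/funext => t; rewrite derive1E.
have d1 := smoothP n (a * t + b) sf; have d2 := is_derive_affine a b t.
have d3 : is_derive t 1 (derive1n n f \o (fun t => a * t + b))
    (derive1n n.+1 f (a * t + b) * a) by exact: is_derive1_comp.
have /@derive_val -> : is_derive t 1
    (a ^+ n \*: (derive1n n f \o (fun t => a * t + b)))
    (a ^+ n *: (derive1n n.+1 f (a * t + b) * a)).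
  exact: is_deriveZ.
by rewrite /GRing.scale /= exprSr -mulrA; congr (_ * _); rewrite mulrC.
Qed.

(** A derivative depends only on the values near a point, so on an open set vanishing passes from
    each derivative to the next. *)
Lemma derive1n_zero (U : set R) g n x : open U -> (forall y, U y -> g y = 0) ->
  U x -> g^`(n) x = 0.
Proof.
move=> oU g0; elim: n x => [|n IH] x Ux; first by rewrite derive1n0 g0.
rewrite derive1nS derive1E (@near_eq_derive _ _ _ _ (cst 0)) ?derive_cst//.
by near=> y; apply: IH; near: y; exact: open_nbhs_nbhs.
Unshelve. all: by end_near. Qed.

End SmoothFunctions.

(** * A smooth step with explicit bounds on its first two derivatives *)

Section SmoothStep.
Variable R : realType.
Implicit Types (p : {poly R}) (t x y : R) (n : nat).

(** Up to the factor [n!], the left side is one term of the exponential series. *)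
Lemma exprn_le_expR n y : 0 <= y -> y ^+ n <= n`!%:R * expR y.
Proof.
move=> y0; case: n => [|n].
  by rewrite expr0 mul1r -expR0 ler_expR.
have := expR_ge1Dxn n y0; have fn : 0 < n.+1`!%:R :> R by rewrite ltr0n fact_gt0.
move=> h; rewrite -ler_pdivrMl// mulrC; apply: le_trans h; lra.
Qed.

(** At [y = 1 / h] the factor [y ^+ 2] becomes the bound [C * h ^+ 2] on [flat p h], which gives
    differentiability at 0. *)
Lemma horner_le_expR p : exists2 C, 0 <= C &
  forall y, 0 <= y -> `|p.[y]| * y ^+ 2 <= C * expR y.
Proof.
exists (\sum_(i < size p) `|p`_i| * (i.+2)`!%:R).
  by apply: sumr_ge0 => i _; rewrite mulr_ge0.
move=> y y0; rewrite horner_coef; apply: (@le_trans _ _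
    ((\sum_(i < size p) `|p`_i| * y ^+ i) * y ^+ 2)).
  apply: ler_wpM2r; first exact: exprn_ge0.
  apply: (le_trans (ler_norm_sum _ _ _)); apply: ler_sum => i _.
  by rewrite normrM (ger0_norm (exprn_ge0 _ y0)).
rewrite !mulr_suml; apply: ler_sum => i _.
rewrite -!mulrA -exprD addn2; apply: ler_wpM2l => //.
exact: exprn_le_expR.
Qed.

Lemma is_derive_quadratic_bound (g : R -> R) (C : R) :
  (forall h, `|g h| <= C * h ^+ 2) -> is_derive (0 : R) 1 g 0.
Proof.
move=> gC; have g0 : g 0 = 0.
  by apply/eqP; rewrite -normr_le0 (le_trans (gC 0))// expr0n mulr0.
have C0 : 0 <= C by have := gC 1; rewrite expr1n mulr1; apply: le_trans.
suff : (fun h : R => h^-1 *: (g (h *: 1 + 0) - g 0)) @ 0^' --> (0 : R).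
  move=> c; apply: DeriveDef; first by apply/cvg_ex; exists 0.
  exact: cvg_lim.
apply/cvgrPdist_le => e e0; near=> h.
have h0 : h != 0 by near: h; exact: nbhs_dnbhs_neq.
rewrite g0 subr0 addr0 sub0r normrN /GRing.scale /= mulr1 normrM normfV.
rewrite ler_pdivrMl ?normr_gt0//; apply: (le_trans (gC h)).
rewrite -real_normK ?num_real// expr2 mulrA mulrC ler_wpM2l//.
(* Adding 1 keeps the divisor positive when [C = 0]. *)
have : `|h| <= e / (C + 1).
  near: h; apply: dnbhs0_le; rewrite divr_gt0//; lra.
rewrite ler_pdivlMr; last by lra.
by apply: le_trans; rewrite mulrDr mulr1 mulrC lerDl.
Unshelve. all: by end_near. Qed.

(* The classical flat functions; [flat 1] is the bump [exp (- 1 / t)], and the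
   family is closed under differentiation. *)
Definition flat p t : R := if 0 < t then p.[t^-1] * expR (- t^-1) else 0.

Lemma flat_le0 p t : t <= 0 -> flat p t = 0.
Proof. by rewrite /flat ltNge => ->. Qed.

Lemma flat_gt0 p t : 0 < t -> flat p t = p.[t^-1] * expR (- t^-1).
Proof. by rewrite /flat => ->. Qed.

(** With [y = 1 / t], the derivative of [p(y) * exp(-y)] in [t] is [(p'(y) - p(y)) * exp(-y)] times
    [dy/dt = - y ^+ 2]. *)
Definition flat_deriv p : {poly R} := 'X^2 * (p - p^`()).

Lemma is_derive_flat p t : is_derive t 1 (flat p) (flat (flat_deriv p) t).
Proof.
rewrite /flat_deriv.
have [t0|t0|->] := ltgtP t 0.
- rewrite flat_le0 ?ltW//; apply: (near_eq_is_derive (f := cst 0)).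
  by near=> u; rewrite flat_le0// ltW//; near: u; exact: lt_nbhsl.
- rewrite flat_gt0//.
  apply: (near_eq_is_derive (f := (fun u : R => p.[u^-1] * expR (- u^-1)) : R -> R)).
    by near=> u; rewrite flat_gt0//; near: u; apply: lt_nbhsr.
  have dV : is_derive t 1 (fun u : R => u^-1) (- t ^- 2 *: 1).
    by apply: is_deriveV; rewrite gt_eqF.
  have dN : is_derive t 1 (fun u : R => - u^-1) (- (- t ^- 2 *: 1)).
    exact: is_deriveN.
  have dE : is_derive t 1 (fun u : R => expR (- u^-1))
      (expR (- t^-1) * (- (- t ^- 2 *: 1))).
    exact: is_derive1_comp.
  have dP : is_derive t 1 (fun u : R => p.[u^-1]) (p^`().[t^-1] * (- t ^- 2 *: 1)).
    by apply: (@is_derive1_comp _ (horner p)).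
  refine (is_derive_eq (is_deriveM dP dE) _).
  rewrite !hornerE /GRing.scale /=; rewrite exprVn; ring.
(* The two formulas meet at 0, where the quadratic bound forces the derivative to be 0. *)
- rewrite flat_le0//; have [C C0 hC] := horner_le_expR p.
  apply: (@is_derive_quadratic_bound _ C) => h.
  have [h0|h0] := leP h 0; first by rewrite flat_le0// normr0 mulr_ge0// sqr_ge0.
  rewrite flat_gt0// normrM (ger0_norm (expR_ge0 _)) expRN ler_pdivrMr ?expR_gt0//.
  have := hC h^-1; rewrite invr_ge0 ltW// => /(_ isT).
  by rewrite exprVn ler_pdivrMr ?exprn_gt0// mulrAC.
Unshelve. all: by end_near. Qed.

Lemma smooth_flat p : smooth (flat p).
Proof.
move=> n; elim: n p => [//|n IH] p.
exact: times_derivable_is_derive (is_derive_flat p) (IH _).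
Qed.


Lemma norm_flat_le p (B : R) t : 0 <= B ->
  (forall y, 0 <= y -> `|p.[y]| <= B * expR y) -> `|flat p t| <= B.
Proof.
move=> B0 pB; have [t0|t0] := leP t 0; first by rewrite flat_le0// normr0.
rewrite flat_gt0// normrM (ger0_norm (expR_ge0 _)) expRN ler_pdivrMr ?expR_gt0//.
by apply: pB; rewrite invr_ge0 ltW.
Qed.

Lemma flat1E t : 0 < t -> flat 1 t = expR (- t^-1).
Proof. by move=> t0; rewrite flat_gt0// -polyC1 hornerC mul1r. Qed.

Lemma flat_deriv1 : flat_deriv 1 = 'X^2.
Proof. by rewrite /flat_deriv -polyC1 derivC subr0 mulr1. Qed.

Lemma flat_deriv2 : flat_deriv 'X^2 = 'X^4 - 'X^3 *+ 2.
Proof. by rewrite /flat_deriv derivXn /=; ring. Qed.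

Lemma flat1_ge0 t : 0 <= flat 1 t.
Proof.
have [t0|t0] := leP t 0; first by rewrite flat_le0.
by rewrite flat1E// expR_ge0.
Qed.

Lemma flat1_le t : t <= 1 -> flat 1 t <= expR (-1).
Proof.
move=> t1; have [t0|t0] := leP t 0; first by rewrite flat_le0// expR_ge0.
by rewrite flat1E// ler_expR lerN2 invf_ge1.
Qed.

Lemma norm_dflat1 t : `|flat (flat_deriv 1) t| <= 2.
Proof.
rewrite flat_deriv1; apply: norm_flat_le => // y y0; rewrite hornerXn.
by rewrite ger0_norm ?exprn_ge0//; exact: (exprn_le_expR 2).
Qed.

(** The polynomial is [y ^+ 4 - 2 * y ^+ 3], and [36 = 4! + 2 * 3!]. *)
Lemma norm_d2flat1 t : `|flat (flat_deriv (flat_deriv 1)) t| <= 36.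
Proof.
rewrite flat_deriv1 flat_deriv2; apply: norm_flat_le => // y y0.
rewrite hornerD hornerN hornerMn !hornerXn.
have h4 := exprn_le_expR 4 y0; have h3 := exprn_le_expR 3 y0.
have y3 := exprn_ge0 3 y0; have y4 := exprn_ge0 4 y0.
rewrite !(factS, fact0) !natrM in h3 h4.
by rewrite -mulr_natl ler_norml; apply/andP; split; lra.
Qed.

(* Composing the bump with itself avoids the usual quotient
   [psi t / (psi t + psi (1 - t))]; the factor [expR 3] makes the step end at
   [1 / 3], which is below the width [5 / 12] available to a gate. *)
Definition sigma t : R := expR 1 * flat 1 (1 - expR 3 * flat 1 t).

Lemma sigma_le0 t : t <= 0 -> sigma t = 1.
Proof.
move=> t0; rewrite /sigma (flat_le0 _ t0) mulr0 subr0 flat1E// invr1.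
by rewrite -expRD subrr expR0.
Qed.

Lemma sigma_ge t : 1 / 3 <= t -> sigma t = 0.
Proof.
move=> t3; rewrite /sigma flat_le0 ?mulr0// subr_le0.
rewrite flat1E; last by lra.
rewrite -expRD -[leLHS]expR0 ler_expR subr_ge0.
by rewrite -[3]invrK lef_pV2 ?posrE; lra.
Qed.

Lemma sigma_ge0 t : 0 <= sigma t.
Proof. by rewrite mulr_ge0 ?expR_ge0 ?flat1_ge0. Qed.

Lemma sigma_le1 t : sigma t <= 1.
Proof.
apply: (@le_trans _ _ (expR 1 * expR (-1))); last by rewrite -expRD subrr expR0.
apply: ler_wpM2l; first exact: expR_ge0.
by apply: flat1_le; rewrite gerBl mulr_ge0 ?expR_ge0 ?flat1_ge0.
Qed.

Lemma smooth_sigma : smooth sigma.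
Proof.
have -> : sigma = (fun t => expR 1 * t + 0) \o flat 1
    \o (fun t => - expR 3 * t + 1) \o flat 1.
  by apply/funext => t; rewrite /sigma /= addr0 mulNr addrC.
by do ?[apply: smooth_comp]; (exact: smooth_affine || exact: smooth_flat).
Qed.

Let psi := flat 1.
Let psi1 := flat (flat_deriv 1).
Let psi2 := flat (flat_deriv (flat_deriv 1)).

Lemma is_derive_inner t :
  is_derive t 1 (fun t => 1 - expR 3 * psi t) (- (expR 3 * psi1 t)).
Proof.
have d := is_derive_flat 1 t.
have dZ : is_derive t 1 (expR 3 \*: flat 1) (expR 3 *: psi1 t) by exact: is_deriveZ.
have -> : (fun t => 1 - expR 3 * psi t) = cst 1 - (expR 3 \*: flat 1) by [].
by apply: is_derive_eq; rewrite sub0r.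
Qed.

Lemma is_derive_sigma t : is_derive t 1 sigma
  (- expR 4 * (psi1 (1 - expR 3 * psi t) * psi1 t)).
Proof.
have d1 := is_derive_inner t.
have d2 := is_derive_flat 1 (1 - expR 3 * psi t).
have d3 : is_derive t 1 (psi \o (fun t => 1 - expR 3 * psi t))
   (psi1 (1 - expR 3 * psi t) * - (expR 3 * psi1 t)) by exact: is_derive1_comp.
have -> : sigma = expR 1 \*: (psi \o (fun t => 1 - expR 3 * psi t)) by [].
apply: is_derive_eq; rewrite /GRing.scale /=.
have -> : expR 4 = expR 1 * expR 3 :> R by rewrite -expRD; congr expR; lra.
ring.
Qed.

Lemma is_derive2_sigma t : is_derive t 1
  (fun t => - expR 4 * (psi1 (1 - expR 3 * psi t) * psi1 t))
  (- expR 4 * (psi1 (1 - expR 3 * psi t) * psi2 t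
              - expR 3 * (psi2 (1 - expR 3 * psi t) * psi1 t ^+ 2))).
Proof.
have d1 := is_derive_inner t.
have d2 := is_derive_flat (flat_deriv 1) (1 - expR 3 * psi t).
have d3 : is_derive t 1 (psi1 \o (fun t => 1 - expR 3 * psi t))
   (psi2 (1 - expR 3 * psi t) * - (expR 3 * psi1 t)) by exact: is_derive1_comp.
have d4 := is_derive_flat (flat_deriv 1) t.
have d5 := is_deriveM d3 d4.
have -> : (fun t => - expR 4 * (psi1 (1 - expR 3 * psi t) * psi1 t))
  = - expR 4 \*: ((psi1 \o (fun t => 1 - expR 3 * psi t)) * psi1) by [].
by apply: is_derive_eq; rewrite /GRing.scale /= -/psi1 -/psi2; ring.
Qed.

(** Both factors [psi1] are at most 2 in absolute value, and [2 * 2 <= 1 + 8 <= expR 8]. *)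
Lemma norm_dsigma t : `|derive1n 1 sigma t| <= expR 12.
Proof.
rewrite derive1n1 derive1E; have [_ ->] := is_derive_sigma t.
rewrite !normrM normrN (ger0_norm (expR_ge0 _)).
apply: (@le_trans _ _ (expR 4 * expR 8)); last by rewrite -expRD ler_expR; lra.
apply: ler_wpM2l; first exact: expR_ge0.
have := expR_ge1Dx (8 : R); have : `|psi1 t| <= 2 := norm_dflat1 t.
have := norm_dflat1 (1 - expR 3 * psi t); rewrite -/psi1.
have := normr_ge0 (psi1 t); have := normr_ge0 (psi1 (1 - expR 3 * psi t)).
nra.
Qed.

(** Apart from the factor [expR 4], the bounds 2 and 36 give [72 + 144 * expR 3]. This is at most
    [162 * expR 3] since [expR 3 >= 4], and [12 * expR 17 >= 12 * 18 = 216] leaves room. *)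
Lemma norm_d2sigma t : `|derive1n 2 sigma t| <= 12 * expR 24.
Proof.
rewrite derive1nS derive1n1.
have -> : derive1 sigma = fun t => - expR 4 * (psi1 (1 - expR 3 * psi t) * psi1 t).
  by apply/funext => u; rewrite derive1E; have [_ ->] := is_derive_sigma u.
rewrite derive1E; have [_ ->] := is_derive2_sigma t.
rewrite !normrM normrN (ger0_norm (expR_ge0 _)).
apply: (@le_trans _ _ (expR 4 * (12 * expR 20))); last first.
  by rewrite mulrCA -expRD; apply: ler_wpM2l => //; rewrite ler_expR; lra.
apply: ler_wpM2l; first exact: expR_ge0.
have -> : expR 20 = expR 3 * expR 17 :> R by rewrite -expRD; congr expR; lra.
apply: (le_trans (ler_normB _ _)); rewrite !normrM -expr2 (ger0_norm (expR_ge0 _)).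
have e17 := expR_ge1Dx (17 : R); have e3 := expR_ge1Dx (3 : R).
have a := norm_dflat1 t; have b := norm_dflat1 (1 - expR 3 * psi t).
have a2 := norm_d2flat1 t; have b2 := norm_d2flat1 (1 - expR 3 * psi t).
rewrite -/psi1 -/psi2 in a b a2 b2.
have h1 : `|psi1 (1 - expR 3 * psi t)| * `|psi2 t| <= 2 * 36 by apply: ler_pM.
have h2 : `|psi2 (1 - expR 3 * psi t)| * `|psi1 t| ^+ 2 <= 36 * 2 ^+ 2.
  by apply: ler_pM => //; rewrite lerXn2r ?nnegrE.
have h3 := ler_wpM2l (expR_ge0 (3 : R)) h2.
nra.
Qed.

End SmoothStep.

(** * Mean value estimates in several variables and matrix norms *)

Section MultivariateCalculus.
Variables (R : realType) (d : nat).
Local Notation point := 'cV[R]_d.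
Implicit Types (f : point -> R) (x y z v w : point) (A : 'M[R]_d).

(** Turns directional derivatives into derivatives of one variable, where the mean value theorem and
    the product and chain rules apply. *)
Lemma is_derive_line f x v (t l : R) :
  is_derive (t *: v + x) v f l <-> is_derive t 1 (fun u => f (u *: v + x)) l.
Proof.
have q : (fun h : R => h^-1 *: ((f \o shift (t *: v + x)) (h *: v) - f (t *: v + x)))
   = (fun h : R => h^-1 *: (((fun u => f (u *: v + x)) \o shift t) (h *: 1)
                  - f (t *: v + x))).
  apply/funext => h /=; congr (_ *: (f _ - _)).
  by rewrite /GRing.scale /= mulr1 addrA -scalerDl.
split=> -[D E]; apply: DeriveDef.
- by rewrite /derivable -q.
- by rewrite /derive -q.
- by rewrite /derivable q.
- by rewrite /derive q.
Qed.

Lemma increment_along f (f' : R -> R) (K s : R) x v :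
    (forall t, is_derive (t *: v + x) v f (f' t)) ->
    (forall t, `|t| <= `|s| -> `|f' t| <= K) ->
  `|f (s *: v + x) - f x| <= K * `|s|.
Proof.
move=> ff' Kf'; pose g u := f (u *: v + x).
have gg' (t : R) : is_derive t 1 g (f' t) by apply/is_derive_line.
have cg : continuous g.
  by move=> t; apply/differentiable_continuous/derivable1_diffP; have [] := gg' t.
have -> : f x = g 0 by rewrite /g scale0r add0r.
have mvt a b : a <= b -> exists2 c, c \in `[a, b]%R & g b - g a = f' c * (b - a).
  move=> ab; apply: MVT_segment => //.
  by apply: continuous_subspaceT => ?; exact: cg.
have [s0|s0] := leP 0 s.
  have [c] := mvt _ _ s0; rewrite in_itv /= => /andP[c0 cs] ->.
  rewrite subr0 normrM ler_wpM2r// Kf'// !ger0_norm//.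
have [c] := mvt _ _ (ltW s0); rewrite in_itv /= => /andP[c0 cs].
rewrite distrC => ->; rewrite sub0r normrM normrN ler_wpM2r// Kf'//.
by rewrite [`|c|]ler0_norm// [`|s|]ler0_norm ?lerN2// ltW.
Qed.

Lemma norm_coord_le x i : `|x i 0| <= `|x|.
Proof.
by rewrite [leRHS]/Num.Def.normr /= mx_normrE; apply/bigmax_geP; right => /=; exists (i, 0).
Qed.

Lemma norm_le_coord x (B : R) :
  0 <= B -> (forall i, `|x i 0| <= B) -> `|x| <= B.
Proof.
move=> B0 xB; rewrite [leLHS]/Num.Def.normr /= mx_normrE (bigmax_le _ B0)//= => -[i j] _.
by rewrite /= ord1.
Qed.

(* The points of the box spanned by [x] and [y] are joined to [y] by changing
   one coordinate at a time. *)
Lemma increment_le f (f' : 'I_d -> point -> R) (K : R) x y :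
    (forall z j, is_derive z (delta_mx j 0) f (f' j z)) ->
    (forall w j, (forall i, `|w i 0 - y i 0| <= `|x i 0 - y i 0|) ->
      `|f' j w| <= K) ->
  `|f x - f y| <= K * \sum_i `|x i 0 - y i 0|.
Proof.
move=> ff' Kf'.
pose mix (s : seq 'I_d) : point := \col_i (if i \in s then x i 0 else y i 0).
have -> : x = mix (enum 'I_d) by apply/matrixP => i j; rewrite !mxE mem_enum ord1.
have {1}-> : y = mix [::] by apply/matrixP => i j; rewrite !mxE ord1.
have -> : \sum_i `|mix (enum 'I_d) i 0 - y i 0| = \sum_(i <- enum 'I_d) `|x i 0 - y i 0|.
  by rewrite big_enum; apply: eq_bigr => i _; rewrite mxE mem_enum.
elim: (enum 'I_d) (enum_uniq 'I_d) => [|j s IH] /=.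
  by rewrite subrr normr0 big_nil mulr0.
move=> /andP[js us]; rewrite big_cons mulrDr.
rewrite -[mix (j :: s)](subrK (mix s)).
have step : mix (j :: s) - mix s = (x j 0 - y j 0) *: delta_mx j 0.
  apply/matrixP => i k; rewrite !mxE ord1 in_cons eqxx andbT.
  have [->|ij] := eqVneq i j; first by rewrite (negbTE js) mulr1.
  by rewrite subrr mulr0.
rewrite step; apply: (le_trans (ler_distD (f (mix s)) _ _)); apply: lerD; last exact: IH.
apply: (@increment_along _ (fun t => f' j (t *: delta_mx j 0 + mix s))) => // t tle.
(* On this segment coordinate [j] is [y j 0 + t], and every other one is that of [x] or of [y], so
   the box is never left. *)
apply: Kf' => i; rewrite !mxE eqxx andbT.
have [->|ij] := eqVneq i j; first by rewrite (negbTE js) mulr1 addrK.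
by rewrite mulr0 add0r; case: ifP => // _; rewrite subrr normr0.
Qed.

Lemma l2norm_ge0 x : 0 <= l2norm x. Proof. exact: sqrtr_ge0. Qed.

Lemma sqr_l2norm x : l2norm x ^+ 2 = \sum_i x i 0 ^+ 2.
Proof. by rewrite sqr_sqrtr// sumr_ge0// => i _; exact: sqr_ge0. Qed.

(** Cauchy-Schwarz against the all-ones vector, obtained by summing
    [|a| * |b| <= (a ^+ 2 + b ^+ 2) / 2] over all pairs. *)
Lemma sqr_sum_norm_le x : (\sum_i `|x i 0|) ^+ 2 <= d%:R * l2norm x ^+ 2.
Proof.
rewrite sqr_l2norm expr2 mulr_suml.
apply: (@le_trans _ _ (\sum_i \sum_j (x i 0 ^+ 2 + x j 0 ^+ 2) / 2)).
  apply: ler_sum => i _; rewrite mulr_sumr; apply: ler_sum => j _.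
  rewrite -(real_normK (num_real (x i 0))) -(real_normK (num_real (x j 0))).
  by have := sqr_ge0 (`|x i 0| - `|x j 0|); lra.
under eq_bigr do rewrite -mulr_suml big_split /= sumr_const card_ord.
rewrite -mulr_suml big_split /= sumr_const card_ord -sumrMnl.
by rewrite sumrMnl -mulr_natl; lra.
Qed.

Lemma sum_norm_le x : \sum_i `|x i 0| <= d%:R * l2norm x.
Proof.
rewrite -[leRHS]ger0_norm ?mulr_ge0 ?l2norm_ge0// -[leLHS]ger0_norm ?sumr_ge0//.
rewrite -ler_sqr ?nnegrE// !real_normK ?num_real// exprMn.
apply: (le_trans (sqr_sum_norm_le x)); apply: ler_wpM2r; first exact: sqr_ge0.
by rewrite -natrX ler_nat; case: (d) => // n; rewrite leq_pmulr.
Qed.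

(** One factor [sqrt d] comes from the [d] coordinates of [w], the other from Cauchy-Schwarz on the
    sum over [v]. *)
Lemma l2norm_le (B : R) v w : 0 <= B ->
  (forall i, `|w i 0| <= B * \sum_j `|v j 0|) -> l2norm w <= B * d%:R * l2norm v.
Proof.
move=> B0 wB; have s0 : 0 <= \sum_j `|v j 0| by apply: sumr_ge0.
rewrite -ler_sqr ?nnegrE ?mulr_ge0 ?l2norm_ge0// sqr_l2norm.
apply: (@le_trans _ _ (\sum_(i < d) (B * \sum_j `|v j 0|) ^+ 2)).
  apply: ler_sum => i _; rewrite -real_normK ?num_real// lerXn2r// nnegrE//.
  exact: mulr_ge0.
rewrite sumr_const card_ord -[_ *+ d]mulr_natr.
rewrite [leLHS](_ : _ = B ^+ 2 * d%:R * (\sum_j `|v j 0|) ^+ 2); last by ring.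
rewrite [leRHS](_ : _ = B ^+ 2 * d%:R * (d%:R * l2norm v ^+ 2)); last by ring.
by apply: ler_wpM2l; [rewrite mulr_ge0 ?sqr_ge0 | exact: sqr_sum_norm_le].
Qed.

Lemma spectral_norm_le (B : R) A : 0 <= B -> (forall i j, `|A i j| <= B) ->
  spectral_norm A <= B * d%:R.
Proof.
move=> B0 AB; apply: sup_le_ub.
  (* Bounding a supremum by an upper bound requires a nonempty set; the zero vector is a witness. *)
  exists (l2norm (A *m 0)); exists 0 => //=.
  by rewrite /l2norm big1 ?sqrtr0// => i _; rewrite mxE expr0n.
move=> _ [x /= x1 <-]; apply: (@le_trans _ _ (B * d%:R * l2norm x)).
  apply: l2norm_le => // i; rewrite mxE mulr_sumr.
  apply: (le_trans (ler_norm_sum _ _ _)); apply: ler_sum => j _.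
  by rewrite normrM ler_wpM2r.
by rewrite ler_piMr// mulr_ge0.
Qed.

End MultivariateCalculus.

(** * Sums of products of one-variable profiles *)

Section Separable.
Variables (R : realType) (d : nat) (X : finType).
Local Notation point := 'cV[R]_d.
Variables (c : X -> R) (p : X -> 'I_d -> R -> R).

Definition bump_at (al : 'I_d -> nat) (j i : 'I_d) : nat := al i + (i == j).

(* The partial derivative of multi-index [al] of the function
   [z |-> \sum_a c a * \prod_i p a i z_i]. *)
Definition separable (al : 'I_d -> nat) (z : point) : R :=
  \sum_a c a * \prod_i derive1n (al i) (p a i) (z i 0).

Hypothesis smooth_p : forall a i, smooth (p a i).

Lemma is_derive_separable al j z :
  is_derive z (delta_mx j 0) (separable al) (separable (bump_at al j) z).
Proof.
suff : is_derive (0 *: delta_mx j 0 + z) (delta_mx j 0) (separable al)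
    (separable (bump_at al j) z) by rewrite scale0r add0r.
apply/is_derive_line; rewrite /separable.
have sum (r : seq X) (h : X -> R -> R) (h' : X -> R) :
    (forall a, is_derive (0 : R) 1 (h a) (h' a)) ->
    is_derive (0 : R) 1 (fun u => \sum_(a <- r) h a u) (\sum_(a <- r) h' a).
  move=> hh'; elim: r => [|a r IH].
    have -> : (fun u : R => \sum_(a <- [::]) h a u) = cst 0.
      by apply/funext => u; rewrite big_nil.
    by rewrite big_nil; exact: is_derive_cst.
  have -> : (fun u : R => \sum_(b <- a :: r) h b u) = h a + (fun u => \sum_(b <- r) h b u).
    by apply/funext => u; rewrite big_cons.
  by rewrite big_cons; exact: is_deriveD.
apply: sum => a.
(* Along the direction [j] these factors stay constant. *)
pose B := \prod_(i < d | i != j) derive1n (al i) (p a i) (z i 0).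
have -> : (fun u : R => c a * \prod_i derive1n (al i) (p a i)
      ((u *: delta_mx j 0 + z) i 0))
  = (c a * B) \*: (derive1n (al j) (p a j) \o (fun u => 1 * u + z j 0)).
  apply/funext => u; rewrite (bigD1 j)//= !mxE !eqxx /GRing.scale /= mulr1 mul1r.
  rewrite -mulrA; congr (_ * _); rewrite mulrC; congr (_ * _).
  by apply: eq_bigr => i ij; rewrite !mxE (negbTE ij) mulr0 add0r.
have d1 := smoothP (al j) (1 * 0 + z j 0) (smooth_p a j).
have d2 := is_derive_affine 1 (z j 0) 0.
have d3 : is_derive (0 : R) 1 (derive1n (al j) (p a j) \o (fun u => 1 * u + z j 0))
    (derive1n (al j).+1 (p a j) (1 * 0 + z j 0) * 1) by exact: is_derive1_comp.
refine (is_derive_eq (is_deriveZ _ d3) _).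
rewrite /GRing.scale /= mulr1 mulr0 add0r (bigD1 j)//= /bump_at eqxx addn1.
rewrite -mulrA; congr (_ * _); rewrite mulrC; congr (_ * _).
by apply: eq_bigr => i ij; rewrite (negbTE ij) addn0.
Qed.

Lemma continuous_separable al : continuous (separable al).
Proof.
apply: continuous_big; first exact: add_continuous.
move=> a _ z; apply: continuousM; first exact: cst_continuous.
move: z; apply: continuous_big => [|i _ z]; first exact: mul_continuous.
apply: (@continuous_comp _ _ _ (fun z : point => z i 0)).
  exact: coord_continuous.
apply/differentiable_continuous/derivable1_diffP.
by have [] := smoothP (al i) (z i 0) (smooth_p a i).
Qed.

Lemma derive_separable al j :
  'D_(delta_mx j 0) (separable al) = separable (bump_at al j).
Proof. by apply/funext => z; have [_ ->] := is_derive_separable al j z. Qed.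

(** The family is closed under partial derivatives and consists of continuous functions, so
    induction on [k] suffices. *)
Lemma Ck_separable k al : Ck k setT (separable al).
Proof.
elim: k al => [|k IH] al; split=> //; try by move=> x _; exact: continuous_separable.
move=> j; split=> [x _|]; first by have [] := is_derive_separable al j x.
by have -> : (fun x => 'D_(delta_mx j 0) (separable al) x) = _ := derive_separable al j.
Qed.

(** One coordinate separates the two terms. The orders [n] and [m] are arbitrary, so the separation
    also holds for all partial derivatives. *)
Definition disjoint_profiles (q r : 'I_d -> R -> R) : Prop :=
  exists i, forall n m t, derive1n n (q i) t = 0 \/ derive1n m (r i) t = 0.

Hypothesis disjoint_p : forall a b, a != b -> disjoint_profiles (p a) (p b).
Hypothesis c01 : forall a, 0 <= c a <= 1.

(* At every point at most one term of the sum survives, together with all its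
   derivatives, so the number of terms does not enter the bounds. *)
Lemma norm_separable_le al (z : point) (B : R) : 0 <= B ->
    (forall a, `|\prod_i derive1n (al i) (p a i) (z i 0)| <= B) ->
  `|separable al z| <= B.
Proof.
move=> B0 pB; rewrite /separable.
pose P a := \prod_i derive1n (al i) (p a i) (z i 0).
have [[a Pa]|P0] := pselect (exists a, P a != 0); last first.
  rewrite big1 ?normr0// => a _; rewrite -/(P a).
  have [->|Pa] := eqVneq (P a) 0; first by rewrite mulr0.
  by case: P0; exists a.
rewrite (bigD1 a)//= [X in _ + X]big1 ?addr0 => [|b ba].
  rewrite normrM -[leRHS]mul1r; apply: ler_pM => //.
  by have /andP[c0 c1] := c01 a; rewrite ger0_norm.
have [i ii] := disjoint_p ba; case: (ii (al i) (al i) (z i 0)) => pi0.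
  by rewrite (bigD1 i)//= pi0 mul0r mulr0.
by move: Pa; rewrite /P (bigD1 i)//= pi0 mul0r eqxx.
Qed.

Hypothesis p01 : forall a i t, 0 <= p a i t <= 1.

Lemma separable01 z : 0 <= separable (fun=> 0%N) z <= 1.
Proof.
apply/andP; split.
  apply: sumr_ge0 => a _; apply: mulr_ge0; first by have /andP[] := c01 a.
  by apply: prodr_ge0 => i _; rewrite derive1n0; have /andP[] := p01 a i (z i 0).
apply: le_trans (ler_norm _) _; apply: norm_separable_le => // a.
rewrite normr_prod; apply: prodr_ile1 => i _; rewrite normr_ge0 derive1n0/=.
by have /andP[c0 c1] := p01 a i (z i 0); rewrite ger0_norm.
Qed.

Variable K : R.
Hypothesis K1 : 1 <= K.
Hypothesis dpK : forall a i t, `|derive1n 1 (p a i) t| <= K.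
Hypothesis d2pK : forall a i t, `|derive1n 2 (p a i) t| <= 12 * K ^+ 2.

Let p0 a i t : `|derive1n 0 (p a i) t| <= 1.
Proof. by rewrite derive1n0; have /andP[? ?] := p01 a i t; rewrite ger0_norm. Qed.

Lemma norm_d1_separable j z : `|separable (bump_at (fun=> 0%N) j) z| <= K.
Proof.
have K0 : 0 <= K by apply: le_trans K1.
apply: norm_separable_le => // a; rewrite normr_prod (bigD1 j)//=.
rewrite -[leRHS]mulr1; apply: ler_pM => //; first exact: prodr_ge0.
  by rewrite /bump_at eqxx; exact: dpK.
apply: prodr_ile1 => i ij; rewrite normr_ge0 /bump_at (negbTE ij)/=.
exact: p0.
Qed.

Lemma norm_d2_separable j k z :
  `|separable (bump_at (bump_at (fun=> 0%N) j) k) z| <= 12 * K ^+ 2.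
Proof.
have K0 : 0 <= K by apply: le_trans K1.
have K20 := sqr_ge0 K.
apply: norm_separable_le; first lra.
move=> a; rewrite normr_prod (bigD1 j)//=.
have [<-|kj] := eqVneq j k.
  rewrite -[leRHS]mulr1; apply: ler_pM => //; first exact: prodr_ge0.
    by rewrite /bump_at eqxx; exact: d2pK.
  apply: prodr_ile1 => i ij; rewrite normr_ge0 /bump_at (negbTE ij)/=.
  exact: p0.
(* A mixed derivative differentiates two distinct factors once each. *)
apply: (@le_trans _ _ (K * K)); last by rewrite -expr2; lra.
apply: ler_pM => //; first exact: prodr_ge0.
  by rewrite /bump_at eqxx (negbTE kj); exact: dpK.
rewrite (bigD1 k) 1?eq_sym//= -[leRHS]mulr1; apply: ler_pM => //.
- exact: prodr_ge0.
- by rewrite /bump_at eqxx eq_sym (negbTE kj); exact: dpK.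
apply: prodr_ile1 => i /andP[ij ik].
by rewrite normr_ge0 /bump_at (negbTE ij) (negbTE ik)/=; exact: p0.
Qed.

End Separable.

(* Cell 1 of the input holds [#|V|], and the outputs overwrite the input cells.
   Register 0 is the loop counter; register 3 is never written, so that
   [NJumpLe 3 3 t] is an unconditional jump. *)
Definition recovery : program :=
  [:: NConst 1 1; NLoad 2 1; NConst 4 2; RConst 1 (1 / 12); RConst 2 (11 / 12);
      NJumpLe 2 0 16;
      RLoad 0 0; RJumpLe 0 1 11; RJumpLe 2 0 13;
      NStore 0 4; NJumpLe 3 3 14;
      NStore 0 3; NJumpLe 3 3 14;
      NStore 0 1;
      NAdd 0 0 1; NJumpLe 3 3 5].

(** * Correctness and running time of the recovery program *)

Section Recovery.
Variable R : realType.
Implicit Types (s : state R) (t : R).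

Definition code_of t : nat :=
  if t <= 1 / 12 then 0 else if 11 / 12 <= t then 1 else 2.

(** Holds at the loop head, instruction 5, once [k] outputs are written. The bound [n] sits in a
    register because writing the outputs overwrites cell 1. *)
Definition loop_inv (n : nat) (q : nat -> R) (k : nat) s : Prop :=
  [/\ [/\ pc s = 5, rmem s = q, rreg s 1 = 1 / 12 & rreg s 2 = 11 / 12],
      [/\ nreg s 0 = k, nreg s 1 = 1%N, nreg s 2 = n, nreg s 3 = 0%N
       & nreg s 4 = 2%N]
    & forall a, (a < k)%N -> nmem s a = code_of (q a)].

(** A pass takes 7 steps when the coordinate rounds to 0 or 1, and 8 when it rounds to bot. *)
Lemma loop_step n q k s : loop_inv n q k s -> (k < n)%N ->
  exists2 m, (m <= 8)%N & loop_inv n q k.+1 (iter m (step recovery) s).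
Proof.
case: s => p nr nm rr rm [[/= -> -> r1 r2] [n0 n1 n2 n3 n4] inv] kn.
have s1 : step recovery (State 5 nr nm rr q) = State 6 nr nm rr q.
  by rewrite /step /= n2 n0 leqNgt kn.
pose rr' := [eta rr with 0%N |-> q (nr 0)].
have s2 : step recovery (State 6 nr nm rr q) = State 7 nr nm rr' q by [].
have s3 : step recovery (State 7 nr nm rr' q)
    = State (if q k <= 1 / 12 then 11 else 8) nr nm rr' q.
  by rewrite /step /= r1 n0.
have s4 : step recovery (State 8 nr nm rr' q)
    = State (if 11 / 12 <= q k then 13 else 9) nr nm rr' q.
  by rewrite /step /= r2 n0.
have sj nr' nm' : step recovery (State 12 nr' nm' rr' q) = State 14 nr' nm' rr' q.
  by rewrite /step /= leqnn.
have sj' nr' nm' : step recovery (State 10 nr' nm' rr' q) = State 14 nr' nm' rr' q.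
  by rewrite /step /= leqnn.
pose nr2 := [eta nr with 0%N |-> (nr 0 + nr 1)%N].
have s5 nm' : step recovery (State 14 nr nm' rr' q) = State 15 nr2 nm' rr' q by [].
have s6 nm' : step recovery (State 15 nr2 nm' rr' q) = State 5 nr2 nm' rr' q.
  by rewrite /step /= leqnn.
have fin nm' : nm' = [eta nm with nr 0 |-> code_of (q k)] ->
    loop_inv n q k.+1 (State 5 nr2 nm' rr' q).
  move=> ->; split=> //=; first by split=> //; rewrite n0 n1 addn1.
  move=> a; rewrite ltnS leq_eqVlt n0 => /orP[/eqP ->|ak]; first by rewrite eqxx.
  by rewrite (ltn_eqF ak) inv.
have [c1|c1] := boolP (q k <= 1 / 12).
  exists 7 => //; rewrite !iterSr s1 s2 s3 c1.
  have -> : step recovery (State 11 nr nm rr' q)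
    = State 12 nr [eta nm with nr 0 |-> nr 3] rr' q by [].
  rewrite sj s5 s6; apply: fin; rewrite /code_of c1 n3//.
have [c2|c2] := boolP (11 / 12 <= q k).
  exists 7 => //; rewrite !iterSr s1 s2 s3 (negbTE c1) s4 c2.
  have -> : step recovery (State 13 nr nm rr' q)
    = State 14 nr [eta nm with nr 0 |-> nr 1] rr' q by [].
  by rewrite s5 s6; apply: fin; rewrite /code_of (negbTE c1) c2 n1.
exists 8 => //; rewrite !iterSr s1 s2 s3 (negbTE c1) s4 (negbTE c2).
have -> : step recovery (State 9 nr nm rr' q)
  = State 10 nr [eta nm with nr 0 |-> nr 4] rr' q by [].
by rewrite sj' s5 s6; apply: fin; rewrite /code_of (negbTE c1) (negbTE c2) n4.
Qed.

Lemma loop_run n q s : loop_inv n q 0 s -> forall k, (k <= n)%N ->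
  exists2 m, (m <= 8 * k)%N & loop_inv n q k (iter m (step recovery) s).
Proof.
move=> inv0; elim=> [|k IH] kn; first by exists 0%N.
have [m mk invk] := IH (ltnW kn).
have [m' m'8 invk'] := loop_step invk kn.
by exists (m' + m)%N; rewrite ?iterD// mulnS leq_add.
Qed.

Variables (N : nat) (V : finType) (C : circuit N V).

(** Every node is the output of a gate, so its code occurs in the encoding, and distinct nodes have
    distinct codes. *)
Lemma card_le_size_encode : (#|V| <= size (encode C))%N.
Proof.
pose S := [seq node_code v | v <- enum V].
have uS : uniq S.
  rewrite map_inj_uniq ?enum_uniq// => u v /val_inj/enum_rank_inj //.
have <- : size S = #|V| by rewrite size_map -cardE.
apply: uniq_leq_size => // _ /mapP[v _ ->].
have := output_once C v.
rewrite /encode !mem_cat.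
have [/eqP c1|] := boolP (#|[set g in nor_gates C | v == g.2]| == 0).
  have [/eqP c2|] := boolP (#|[set g in purify_gates C | (v == g.1.2) || (v == g.2)]| == 0).
    rewrite c1 c2 !add0n => c3.
    have /card_gt0P[g] : (0 < #|[set g in oracle_gates C | v == g.2]|)%N by rewrite c3.
    rewrite inE => /andP[gC /eqP ->].
    do 3!(apply/orP; right); apply/flattenP.
    exists [seq node_code x | x <- rcons (val g.1) g.2].
      by apply/mapP; exists g; rewrite ?mem_enum.
    by rewrite map_f// mem_rcons in_cons eqxx.
  rewrite -lt0n => /card_gt0P[g]; rewrite inE => /andP[gC gv] _.
  apply/orP; right; apply/orP; right; apply/orP; left; apply/flattenP.
  exists [seq node_code x | x <- [:: g.1.1; g.1.2; g.2]].
    by apply/mapP; exists g; rewrite ?mem_enum.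
  by rewrite map_f// !in_cons; case/orP: gv => ->; rewrite ?orbT.
rewrite -lt0n => /card_gt0P[g]; rewrite inE => /andP[gC gv] _.
apply/orP; right; apply/orP; left; apply/flattenP.
exists [seq node_code x | x <- [:: g.1.1; g.1.2; g.2]].
  by apply/mapP; exists g; rewrite ?mem_enum.
by rewrite map_f// !in_cons gv !orbT.
Qed.

Definition decode (z : 'cV[R]_#|V|) (v : V) : option bool :=
  let t := z (enum_rank v) 0 in
  if t <= 1 / 12 then Some false else if 11 / 12 <= t then Some true else None.

Lemma recovers_decode (z : 'cV[R]_#|V|) : recovers recovery 8 C z (decode z).
Proof.
pose q a : R := if insub a is Some i then z i 0 else 0.
have inv0 : loop_inv #|V| q 0 (iter 5 (step recovery) (init_state C z)).
  by split=> //; split=> //=; rewrite !rmorphM ?fmorphV ?rmorph_nat ?rmorph1.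
have [m mV invV] := loop_run inv0 (leqnn _).
set s := iter m _ _ in invV.
have sE : s = iter (m + 5) (step recovery) (init_state C z) by rewrite iterD.
case: s invV sE => p nr nm rr rm [[/= -> -> _ _] [n0 _ n2 _ _] out] sE.
pose f := State 16 nr nm rr q.
(* Five initializing steps, [m] steps in the loop, and the jump out of it. *)
have sf : iter (m + 6) (step recovery) (init_state C z) = f.
  by rewrite addnS iterS -sE /step /= n0 n2 leqnn.
have stop k : iter k (step recovery) f = f by elim: k => //= k ->.
have key T : (m + 6 <= T)%N ->
    halted recovery (iter T (step recovery) (init_state C z)) /\
    decode z = output (iter T (step recovery) (init_state C z)).
  move=> mT; rewrite -(subnK mT) iterD sf stop; split=> //; apply/funext => v.
  rewrite /output /decode /= out ?ltn_ord// /code_of /q valK.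
  by case: ifP => // _; case: ifP.
apply: key; have eV := card_le_size_encode.
(* The header alone has 5 entries. Hence [8 * e ^ 8 >= 40 * e], which exceeds the [8 * #|V| + 6]
   steps needed. *)
have : (5 <= size (encode C))%N by rewrite /encode size_cat /= leq_addr.
move: (size (encode C)) eV => e eV e5.
have h : (e * 5 <= e ^ 8)%N.
  by rewrite expnS leq_mul2l (leq_trans e5) ?orbT// -{1}[e]expn1 leq_pexp2l ?(leq_trans _ e5).
by move: mV eV e5 h; clear; move: (e ^ 8)%N #|V| => x y; lia.
Qed.

End Recovery.

(** * Vector fields with bounded first and second partial derivatives *)

Section TameFields.
Variables (R : realType) (d : nat) (K : R).
Local Notation point := 'cV[R]_d.
Implicit Types (x y z : point) (al : 'I_d -> nat).

(* [f al] stands for the partial derivative of multi-index [al]. *)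
Record tame (f : ('I_d -> nat) -> point -> R) : Prop := Tame {
  tame_derive : forall al j z,
    is_derive z (delta_mx j 0) (f al) (f (bump_at al j) z);
  tame_Ck : forall k al, Ck k setT (f al);
  tame01 : forall z, 0 <= f (fun=> 0%N) z <= 1;
  tame_d1 : forall j z, `|f (bump_at (fun=> 0%N) j) z| <= K;
  tame_d2 : forall j k z, `|f (bump_at (bump_at (fun=> 0%N) j) k) z| <= 12 * K ^+ 2
}.

Variable f : 'I_d -> ('I_d -> nat) -> point -> R.
Hypothesis tame_f : forall i, tame (f i).
Hypothesis K0 : 0 <= K.

Definition field z : point := \col_i f i (fun=> 0%N) z.
Definition jacobian z : 'M[R]_d := \matrix_(i, j) f i (bump_at (fun=> 0%N) j) z.

Let M := 12 * K ^+ 2.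
Let M0 : 0 <= M. Proof. by rewrite mulr_ge0 ?sqr_ge0. Qed.

Lemma field_maps z : cube z -> cube (field z).
Proof. by move=> _ i; rewrite mxE; exact: tame01. Qed.

Lemma field_lipschitz : lipschitz_cube (K * d%:R) field.
Proof.
move=> x y _ _; apply: l2norm_le => // i; rewrite !mxE.
under eq_bigr do rewrite !mxE.
apply: (@increment_le _ _ _ (fun j => f i (bump_at (fun=> 0%N) j))) => [z j|w j _].
  exact: tame_derive.
exact: tame_d1.
Qed.

Lemma jacobian_increment x y i j :
  `|jacobian x i j - jacobian y i j| <= M * \sum_k `|x k 0 - y k 0|.
Proof.
rewrite !mxE; apply: (@increment_le _ _ _
    (fun k => f i (bump_at (bump_at (fun=> 0%N) j) k))) => [z k|w k _].
  exact: tame_derive.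
exact: tame_d2.
Qed.

(** One factor [d] passes from the sum norm to the Euclidean norm, the other from the entries to the
    spectral norm. *)
Lemma jacobian_smooth : smooth_cube (M * d%:R ^+ 2) jacobian.
Proof.
move=> x y _ _.
have B0 : 0 <= M * (d%:R * l2norm (x - y)) by rewrite !mulr_ge0 ?l2norm_ge0.
have -> : M * d%:R ^+ 2 * l2norm (x - y) = M * (d%:R * l2norm (x - y)) * d%:R by ring.
apply: spectral_norm_le => // i j; rewrite mxE [X in _ + X]mxE.
apply: (le_trans (jacobian_increment _ _ _ _)); apply: ler_wpM2l => //.
apply: le_trans (sum_norm_le _); apply: ler_sum => k _.
by rewrite !mxE.
Qed.

(** Subtracting from a component its linear part at [z] leaves a function [h] whose partial
    derivatives are increments of the Jacobian. In the box spanned by [x] and [z] these are at most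
    [M * S], and the mean value estimate contributes a second factor [S]. *)
Lemma field_taylor x z :
  `|field x - field z - jacobian z *m (x - z)| <= M * (d%:R * `|x - z|) ^+ 2.
Proof.
apply: norm_le_coord => [|i]; first by rewrite mulr_ge0 ?sqr_ge0.
set S := \sum_k `|x k 0 - z k 0|.
have S0 : 0 <= S by apply: sumr_ge0.
have SE : S <= d%:R * `|x - z|.
  rewrite mulr_natl -[d in _ *+ d]card_ord -sumr_const; apply: ler_sum => k _.
  by have := norm_coord_le (x - z) k; rewrite !mxE.
pose a k := f i (bump_at (fun=> 0%N) k) z.
pose h (w : point) := f i (fun=> 0%N) w - \sum_k a k * w k 0.
have -> : (field x - field z - jacobian z *m (x - z)) i 0 = h x - h z.
  rewrite !mxE /h; under eq_bigr do rewrite !mxE mulrBr.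
  by rewrite sumrB -/a; ring.
have hh' w j : is_derive w (delta_mx j 0) h (f i (bump_at (fun=> 0%N) j) w - a j).
  have d1 : is_derive w (delta_mx j 0) (f i (fun=> 0%N)) (f i (bump_at (fun=> 0%N) j) w).
    exact: tame_derive.
  have d2 : is_derive w (delta_mx j 0) (fun w : point => \sum_k a k * w k 0) (a j).
    have -> : a j = \sum_k a k * (delta_mx j 0 : point) k 0.
      rewrite (bigD1 j)//= big1 => [|k kj]; first by rewrite mxE !eqxx mulr1 addr0.
      by rewrite mxE (negbTE kj) mulr0.
    suff : is_derive (0 *: delta_mx j 0 + w) (delta_mx j 0)
        (fun w : point => \sum_k a k * w k 0) (\sum_k a k * (delta_mx j 0 : point) k 0).
      by rewrite scale0r add0r.
    apply/is_derive_line.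
    have -> : (fun u : R => \sum_k a k * (u *: delta_mx j 0 + w) k 0)
        = (fun u => (\sum_k a k * (delta_mx j 0 : point) k 0) * u
                      + \sum_k a k * w k 0).
      apply/funext => u; rewrite mulr_suml -big_split; apply: eq_bigr => k _ /=.
      by rewrite !mxE; ring.
    exact: is_derive_affine.
  exact: is_deriveB.
apply: (@le_trans _ _ (M * S * S)).
  apply: (increment_le (f' := fun j w => f i (bump_at (fun=> 0%N) j) w - a j)) => // w j box.
  have := jacobian_increment w z i j; rewrite !mxE; move=> /le_trans; apply.
  by apply: ler_wpM2l => //; apply: ler_sum.
by rewrite -mulrA -expr2 ler_wpM2l// lerXn2r ?nnegrE// (le_trans S0).
Qed.

Lemma field_is_jacobian : is_jacobian field jacobian.
Proof.
move=> z _ e e0; apply: cvg_within; apply/nbhs_ballP.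
have P0 : 0 <= M * d%:R ^+ 2 by rewrite mulr_ge0 ?sqr_ge0.
exists (e / (M * d%:R ^+ 2 + 1)) => /=; first by rewrite divr_gt0// ltr_wpDl.
move=> x; rewrite mx_norm_ball /ball_ /= distrC => /ltW xz.
apply: (le_trans (field_taylor x z)).
rewrite exprMn mulrA [`|x - z| ^+ 2]expr2 mulrA; apply: ler_wpM2r => //.
move: xz; rewrite ler_pdivlMr; last by rewrite ltr_wpDl.
by apply: le_trans; rewrite mulrDr mulr1 mulrC lerDl.
Qed.

Lemma field_Coo : Coo_cube field.
Proof.
(* The formula makes sense on the whole space, so the field is its own extension. *)
exists setT, field; split=> //; first exact: openT.
move=> k i; have -> : (fun z => field z i 0) = f i (fun=> 0%N).
  by apply/funext => z; rewrite mxE.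
exact: tame_Ck.
Qed.

Lemma field_C1 : Ck_cube 1 field.
Proof. by have [U [G [oU cU GF ck]]] := field_Coo; exists U, G. Qed.

Definition field_instance (eps : R) (eps0 : 0 < eps) : smooth_brouwer R d :=
  SmoothBrouwer eps0 field_maps
    (ex_intro (fun G => lipschitz_cube G field) _ field_lipschitz)
    field_C1 field_is_jacobian.

End TameFields.

(** * The step profiles used by the gates *)

Section StepProfiles.
Variable R : realType.
Implicit Types (a b t : R).

(* [profile 0 0] is the constant 1. *)
Definition profile a b t : R := sigma (a * t + b).

Lemma smooth_profile a b : smooth (profile a b).
Proof. exact: (smooth_comp (@smooth_sigma R) (smooth_affine a b)). Qed.

Lemma profile01 a b t : 0 <= profile a b t <= 1.
Proof. by rewrite sigma_ge0 sigma_le1. Qed.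

Lemma norm_d1_profile a b t : `|a| <= 1 -> `|derive1n 1 (profile a b) t| <= expR 12.
Proof.
move=> a1; rewrite derive1n_affine; last exact: smooth_sigma.
by rewrite normrM expr1 -[leRHS]mul1r ler_pM ?norm_dsigma.
Qed.

Lemma norm_d2_profile a b t : `|a| <= 1 ->
  `|derive1n 2 (profile a b) t| <= 12 * expR 12 ^+ 2.
Proof.
move=> a1; rewrite derive1n_affine; last exact: smooth_sigma.
have -> : expR 12 ^+ 2 = expR 24 :> R by rewrite expr2 -expRD; congr expR; lra.
rewrite normrM normrX -[leRHS]mul1r ler_pM ?norm_d2sigma//.
by rewrite exprn_ile1.
Qed.

Definition one_profile : R -> R := profile 0 0.
Definition low_profile : R -> R := profile 1 (- (1 / 12)).
Definition mid_profile : R -> R := profile (-1) (1 / 2).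
Definition high_profile : R -> R := profile (-1) (11 / 12).

Lemma one_profileE t : one_profile t = 1.
Proof. by rewrite /one_profile /profile mul0r add0r sigma_le0. Qed.

Lemma low_profile1 t : t <= 1 / 12 -> low_profile t = 1.
Proof. by move=> ?; apply: sigma_le0; lra. Qed.

Lemma low_profile0 t : 5 / 12 <= t -> low_profile t = 0.
Proof. by move=> ?; apply: sigma_ge; lra. Qed.

Lemma mid_profile1 t : 1 / 2 <= t -> mid_profile t = 1.
Proof. by move=> ?; apply: sigma_le0; lra. Qed.

Lemma mid_profile0 t : t <= 1 / 12 -> mid_profile t = 0.
Proof. by move=> ?; apply: sigma_ge; lra. Qed.

Lemma high_profile1 t : 11 / 12 <= t -> high_profile t = 1.
Proof. by move=> ?; apply: sigma_le0; lra. Qed.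

Lemma high_profile0 t : t <= 1 / 2 -> high_profile t = 0.
Proof. by move=> ?; apply: sigma_ge; lra. Qed.

(** The strict inequality describes an open set. Together with the open set [t < 7 / 12] of the next
    lemma it covers the line, so low and high are never both active. *)
Lemma derive1n_low_profile n t : 5 / 12 < t -> derive1n n low_profile t = 0.
Proof.
move=> t0; apply: (@derive1n_zero _ [set u | 5 / 12 < u]) => //.
by move=> u /= /ltW; exact: low_profile0.
Qed.

Lemma derive1n_high_profile n t : t < 7 / 12 -> derive1n n high_profile t = 0.
Proof.
move=> t0; apply: (@derive1n_zero _ [set u | u < 7 / 12]) => //.
by move=> u /= u7; apply: sigma_ge; lra.
Qed.

End StepProfiles.

(** * Facts on tuples, choice in finite sets and counting *)

Lemma neq_tuple_tnth (n : nat) (T : eqType) (s t : n.-tuple T) :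
  s != t -> exists k, tnth s k != tnth t k.
Proof.
move=> st; have [k k_neq|same] := pickP (fun k => tnth s k != tnth t k).
  by exists k.
by case/eqP: st; apply/eq_from_tnth => k; apply/eqP; rewrite -[_ == _]negbK same.
Qed.

Lemma pick_single (T : finType) (A : {set T}) (P : pred T) g :
  (#|[set h in A | P h]| <= 1)%N -> g \in A -> P g ->
  [pick h in A | P h] = Some g.
Proof.
move=> A1 gA Pg; case: pickP => [h /andP[hA Ph]|/(_ g)]; last by rewrite gA Pg.
congr Some; move/card_le1_eqP: A1; apply; rewrite inE; exact/andP.
Qed.

Lemma pick_none (T : finType) (A : {set T}) (P : pred T) :
  #|[set h in A | P h]| = 0%N -> [pick h in A | P h] = None.
Proof.
move/eqP; rewrite cards_eq0 => /eqP A0; case: pickP => // h /andP[hA Ph].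
have : h \in [set h in A | P h] by rewrite inE hA.
by rewrite A0 inE.
Qed.

Lemma card_sep_gt0 (T : finType) (A : {set T}) (P : pred T) g :
  g \in A -> P g -> (0 < #|[set h in A | P h]|)%N.
Proof. by move=> gA Pg; apply/card_gt0P; exists g; rewrite inE gA. Qed.

(** Applied to the numbers of Nor, Purify and Oracle gates with a given output; the last two claims
    rule out the kinds that [gate_of] tests earlier. *)
Lemma addn3_eq1 (a b c : nat) : (a + b + c = 1)%N ->
  [/\ (a <= 1)%N, (b <= 1)%N, (c <= 1)%N, ((0 < b)%N -> a = 0%N)
    & ((0 < c)%N -> a = 0%N /\ b = 0%N)].
Proof. by move=> abc; split; lia. Qed.

(** * The function attached to each gate *)

Section CircuitField.
Variables (R : realType) (N : nat) (V : finType) (C : circuit N V).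
Local Notation d := #|V|.
Local Notation point := 'cV[R]_d.
Implicit Types (L : N.-tuple bool -> bool) (z : point) (al : 'I_d -> nat).

Inductive gate : Type :=
| Nor of V & V
| PurifyFst of V
| PurifySnd of V
| Oracle of N.-tuple V.

(* The gate with output [x]; the last branch never occurs. *)
Definition gate_of (x : V) : gate :=
  if [pick g in nor_gates C | x == g.2] is Some g then Nor g.1.1 g.1.2
  else if [pick g in purify_gates C | (x == g.1.2) || (x == g.2)] is Some g then
    if x == g.1.2 then PurifyFst g.1.1 else PurifySnd g.1.1
  else if [pick g in oracle_gates C | x == g.2] is Some g then Oracle g.1
  else PurifyFst x.

Lemma gate_of_nor u v w : (u, v, w) \in nor_gates C -> gate_of w = Nor u v.
Proof.
move=> g; have g0 := card_sep_gt0 (P := fun h => w == h.2) g (eqxx w).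
have [a1 b1 c1 ab abc] := addn3_eq1 (output_once C w).
by rewrite /gate_of (pick_single (g := (u, v, w))).
Qed.

Lemma gate_of_purify u v w : (u, v, w) \in purify_gates C ->
  gate_of v = PurifyFst u /\ gate_of w = PurifySnd u.
Proof.
move=> g; have := purify_uniq g.
rewrite /= !inE negb_or andbT => /andP[_ vw]; split.
- have [a1 b1 c1 ab abc] := addn3_eq1 (output_once C v).
  have Pg : (v == (u, v, w).1.2) || (v == (u, v, w).2) by rewrite eqxx.
  have g0 := card_sep_gt0 (P := fun h => (v == h.1.2) || (v == h.2)) g Pg.
  rewrite /gate_of pick_none; last exact: ab.
  rewrite (pick_single (g := (u, v, w)))//=.
  by rewrite eqxx.
have [a1 b1 c1 ab abc] := addn3_eq1 (output_once C w).
have Pg : (w == (u, v, w).1.2) || (w == (u, v, w).2) by rewrite eqxx orbT.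
have g0 := card_sep_gt0 (P := fun h => (w == h.1.2) || (w == h.2)) g Pg.
rewrite /gate_of pick_none; last exact: ab.
rewrite (pick_single (g := (u, v, w)))//=.
by rewrite eq_sym (negbTE vw).
Qed.

Lemma gate_of_oracle us v : (us, v) \in oracle_gates C -> gate_of v = Oracle us.
Proof.
move=> g; have g0 := card_sep_gt0 (P := fun h => v == h.2) g (eqxx v).
have [a1 b1 c1 ab abc] := addn3_eq1 (output_once C v).
have [a0 b0] := abc g0; rewrite /gate_of pick_none// pick_none//.
by rewrite (pick_single (g := (us, v))).
Qed.

Lemma gate_of_uniq v us : gate_of v = Oracle us -> uniq us.
Proof.
rewrite /gate_of; case: pickP => [//|_]; case: pickP => [g _|_]; first by case: ifP.
case: pickP => [[us' v'] /andP[g _] /= [<-]|//].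
by have := oracle_uniq g => /= /andP[].
Qed.

(** Indexed by nodes instead of input positions, because the products of [separable] run over all
    coordinates; nodes that the gate does not read contribute the factor 1. *)
Definition oracle_profile (us : N.-tuple V) (b : N.-tuple bool) (x : V) : R -> R :=
  if x \in us then
    if nth false b (index x us) then @high_profile R else @low_profile R
  else @one_profile R.

Lemma oracle_profile_tnth (us : N.-tuple V) (b : N.-tuple bool) k : uniq us ->
  oracle_profile us b (tnth us k)
  = if tnth b k then @high_profile R else @low_profile R.
Proof.
move=> uu; rewrite /oracle_profile mem_tnth.
have -> : index (tnth us k) us = k.
  by rewrite (tnth_nth (tnth us k)) index_uniq ?size_tuple.
by rewrite -tnth_nth.
Qed.

Definition gate_field L (g : gate) al z : R :=
  match g with
  | Nor u v => separable (fun=> 1)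
      (fun (_ : unit) i => if (enum_val i == u) || (enum_val i == v)
                           then @low_profile R else @one_profile R) al z
  | PurifyFst u => separable (fun=> 1)
      (fun (_ : unit) i => if enum_val i == u then @mid_profile R
                           else @one_profile R) al z
  | PurifySnd u => separable (fun=> 1)
      (fun (_ : unit) i => if enum_val i == u then @high_profile R
                           else @one_profile R) al z
  | Oracle us => separable (fun b => (L b)%:R)
      (fun b i => oracle_profile us b (enum_val i)) al z
  end.

(** Slopes of absolute value at most 1 let every profile inherit the derivative bounds of
    [sigma]. *)
Lemma tame_separable (X : finType) (c : X -> R) (p : X -> 'I_d -> R -> R) :
    (forall a i, exists r s, `|r| <= 1 /\ p a i = profile r s) ->
    (forall a b, a != b -> disjoint_profiles (p a) (p b)) ->
    (forall a, 0 <= c a <= 1) ->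
  tame (expR 12) (separable c p).
Proof.
move=> pp dp c01.
have sp a i : smooth (p a i).
  by have [r [s [_ ->]]] := pp a i; exact: smooth_profile.
have p01 a i t : 0 <= p a i t <= 1.
  by have [r [s [_ ->]]] := pp a i; exact: profile01.
have p1 a i t : `|derive1n 1 (p a i) t| <= expR 12.
  by have [r [s [r1 ->]]] := pp a i; exact: norm_d1_profile.
have p2 a i t : `|derive1n 2 (p a i) t| <= 12 * expR 12 ^+ 2.
  by have [r [s [r1 ->]]] := pp a i; exact: norm_d2_profile.
have e1 : 1 <= expR 12 :> R by rewrite -expR0 ler_expR.
split.
- by move=> al j z; exact: is_derive_separable.
- by move=> k al; exact: Ck_separable.
- by move=> z; exact: separable01.
- by move=> j z; exact: norm_d1_separable.
- by move=> j k z; exact: norm_d2_separable.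
Qed.

Lemma one_affine : exists r s : R, `|r| <= 1 /\ @one_profile R = profile r s.
Proof. by exists 0, 0; rewrite normr0. Qed.
Lemma low_affine : exists r s : R, `|r| <= 1 /\ @low_profile R = profile r s.
Proof. by exists 1, (- (1 / 12)); rewrite normr1. Qed.
Lemma mid_affine : exists r s : R, `|r| <= 1 /\ @mid_profile R = profile r s.
Proof. by exists (-1), (1 / 2); rewrite normrN1. Qed.
Lemma high_affine : exists r s : R, `|r| <= 1 /\ @high_profile R = profile r s.
Proof. by exists (-1), (11 / 12); rewrite normrN1. Qed.

Lemma tame_gate_field L x : tame (expR 12) (gate_field L (gate_of x)).
Proof.
have one01 : unit -> 0 <= (1 : R) <= 1 by move=> _; rewrite ler01 lexx.
case gx : (gate_of x) => [u v|u|u|us] /=.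
- apply: tame_separable => // _ i.
  by case: ifP => _; [exact: low_affine | exact: one_affine].
- apply: tame_separable => // _ i.
  by case: ifP => _; [exact: mid_affine | exact: one_affine].
- apply: tame_separable => // _ i.
  by case: ifP => _; [exact: high_affine | exact: one_affine].
apply: tame_separable => [b i|b b' bb'|b].
- rewrite /oracle_profile; case: ifP => _; last exact: one_affine.
  by case: ifP => _; [exact: high_affine | exact: low_affine].
- have [k bk] := neq_tuple_tnth bb'.
  exists (enum_rank (tnth us k)) => n m t.
  (* At an input where the assignments differ, one has the high profile, flat below [7 / 12], and
     the other the low one, flat above [5 / 12]. *)
  rewrite enum_rankK !oracle_profile_tnth ?(gate_of_uniq gx)//; case: (ltP t (7 / 12)) => t7.
    have h q := @derive1n_high_profile R q t t7.
    by move: bk; case: (tnth b k); case: (tnth b' k) => // _; [left | right].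
  have h q : derive1n q (@low_profile R) t = 0 by apply: derive1n_low_profile; clear -t7; lra.
  by move: bk; case: (tnth b k); case: (tnth b' k) => // _; [right | left].
by case: (L b); rewrite ?lexx ler01.
Qed.

(* The only assignment of the inputs whose term in the sum of an oracle gate
   can be nonzero at [z]. *)
Definition rounding (us : N.-tuple V) z : N.-tuple bool :=
  [tuple 1 / 2 < z (enum_rank (tnth us k)) 0 | k < N].

(** The default string at the other nodes makes every node cost exactly one query. *)
Definition query z (x : V) : N.-tuple bool :=
  if gate_of x is Oracle us then rounding us z else [tuple false | k < N].

(** For every assignment other than the rounding of [z], some input lies where its profile is flat.
    That factor vanishes for every [al], so the same query serves values and derivatives. *)
Lemma gate_field_query L x al z :
  gate_field (fun=> L (query z x)) (gate_of x) al z = gate_field L (gate_of x) al z.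
Proof.
rewrite /query; case gx : (gate_of x) => [//|//|//|us] /=.
rewrite /separable; apply: eq_bigr => b _.
have [->//|bz] := eqVneq b (rounding us z).
have [k bk] := neq_tuple_tnth bz.
suff -> : \prod_i derive1n (al i) (oracle_profile us b (enum_val i)) (z i 0) = 0.
  by rewrite !mulr0.
rewrite (bigD1 (enum_rank (tnth us k)))//= enum_rankK.
rewrite oracle_profile_tnth ?(gate_of_uniq gx)//; move: bk; rewrite tnth_mktuple.
case: (tnth b k); case: ltP => // t2 _.
  by rewrite derive1n_high_profile ?mul0r//; lra.
by rewrite derive1n_low_profile ?mul0r//; lra.
Qed.

End CircuitField.

(** * Procedures that ask a fixed list of queries *)

Section Asking.
Variables (N : nat) (V : finType) (X : Type).
Implicit Types (L : N.-tuple bool -> bool) (vs : seq V) (ans : V -> bool).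

Fixpoint ask (q : V -> N.-tuple bool) (out : (V -> bool) -> X) vs ans :
    oracle_proc N X :=
  if vs is v :: vs' then Query (q v) (fun b => ask q out vs' [eta ans with v |-> b])
  else Answer N (out ans).

Lemma run_ask L q out vs ans :
  run L (ask q out vs ans) = out (fun v => if v \in vs then L (q v) else ans v).
Proof.
elim: vs ans => [//|v vs IH] ans /=; rewrite IH; congr out; apply/funext => w /=.
rewrite in_cons; case: (w \in vs); first by rewrite orbT.
by rewrite orbF; case: eqP => [->|].
Qed.

Lemma num_queries_ask L q out vs ans : num_queries L (ask q out vs ans) = size vs.
Proof. by elim: vs ans => [//|v vs IH] ans /=; rewrite IH. Qed.

End Asking.

(** * The reduction and the recovered solution *)

Section Reduction.
Variables (R : realType) (N : nat) (V : finType) (C : circuit N V).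
Local Notation d := #|V|.
Local Notation point := 'cV[R]_d.
Implicit Types (z : point) (L : N.-tuple bool -> bool).

Definition circuit_field L (i : 'I_d) : ('I_d -> nat) -> point -> R :=
  gate_field L (gate_of C (enum_val i)).

(* An oracle gate queries [L] only once, so [L] may be replaced by the constant
   function with the answer to that query. *)
Definition answered_field (ans : V -> bool) (i : 'I_d) : ('I_d -> nat) -> point -> R :=
  gate_field (fun=> ans (enum_val i)) (gate_of C (enum_val i)).

Definition reduction : simulator R C := {|
  sim_F := fun z => ask (query C z) (fun ans => field (answered_field ans) z)
                        (enum V) xpred0;
  sim_J := fun z => ask (query C z) (fun ans => jacobian (answered_field ans) z)
                        (enum V) xpred0 |}.

Lemma run_sim_F L z : run L (sim_F reduction z) = field (circuit_field L) z.
Proof.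
rewrite run_ask; apply/matrixP => i j; rewrite !mxE /answered_field mem_enum.
exact: gate_field_query.
Qed.

Lemma run_sim_J L z : run L (sim_J reduction z) = jacobian (circuit_field L) z.
Proof.
rewrite run_ask; apply/matrixP => i j; rewrite !mxE /answered_field mem_enum.
exact: gate_field_query.
Qed.

Lemma separable_unit (p : unit -> 'I_d -> R -> R) z :
  separable (fun=> 1) p (fun=> 0%N) z = \prod_i p tt i (z i 0).
Proof.
by rewrite /separable (bigD1 tt)//= [X in _ + X]big1 ?addr0 ?mul1r//; case.
Qed.

Lemma decode_false z x : decode z x = Some false -> z (enum_rank x) 0 <= 1 / 12.
Proof. by rewrite /decode; case: ifP => // _; case: ifP. Qed.

Lemma decode_true z x : decode z x = Some true -> 11 / 12 <= z (enum_rank x) 0.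
Proof. by rewrite /decode; case: ifP => // _; case: ifP. Qed.

Variables (L : N.-tuple bool -> bool) (z : point).
Let val_at x := gate_field L (gate_of C x) (fun=> 0%N) z.
Hypothesis approx_fix : forall x, `|val_at x - z (enum_rank x) 0| <= 1 / 12.

(** Here the tolerance [1 / 12] meets the rounding threshold: an exact value of the gate survives
    the error of the approximate fixed point. *)
Lemma decode_low x : val_at x = 0 -> decode z x = Some false.
Proof.
have := approx_fix x => /[swap] ->; rewrite sub0r normrN => zx.
by rewrite /decode (le_trans (ler_norm _) zx).
Qed.

Lemma decode_high x : val_at x = 1 -> decode z x = Some true.
Proof.
have := approx_fix x => /[swap] ->; rewrite ler_norml => /andP[_ zx].
have z1 : 11 / 12 <= z (enum_rank x) 0 by lra.
by rewrite /decode z1; case: ifP => // z2; exfalso; lra.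
Qed.

Lemma prod_zero (F : 'I_d -> R) x : F (enum_rank x) = 0 -> \prod_i F i = 0.
Proof. by move=> F0; rewrite (bigD1 (enum_rank x))//= F0 mul0r. Qed.

Lemma nor_solution u v w : (u, v, w) \in nor_gates C ->
  (decode z u = Some false /\ decode z v = Some false -> decode z w = Some true) /\
  (decode z u = Some true \/ decode z v = Some true -> decode z w = Some false).
Proof.
move=> /gate_of_nor gw; split=> [[/decode_false u0 /decode_false v0]|uv].
  apply: decode_high; rewrite /val_at gw /= separable_unit big1// => i _.
  have [e|_] := eqVneq (enum_val i) u; first by rewrite -e enum_valK in u0; exact: low_profile1.
  have [e|_] := eqVneq (enum_val i) v; first by rewrite -e enum_valK in v0; exact: low_profile1.
  exact: one_profileE.
apply: decode_low; rewrite /val_at gw /= separable_unit.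
have low0 x : decode z x = Some true -> low_profile (z (enum_rank x) 0) = 0.
  by move/decode_true => zx; apply: low_profile0; lra.
by case: uv => /low0 h; [apply: (@prod_zero _ u) | apply: (@prod_zero _ v)];
  rewrite enum_rankK eqxx ?orbT.
Qed.

Lemma separable_single (p : R -> R) u :
  separable (fun=> 1) (fun (_ : unit) (i : 'I_d) =>
    if enum_val i == u then p else @one_profile R) (fun=> 0%N) z
  = p (z (enum_rank u) 0).
Proof.
rewrite separable_unit (bigD1 (enum_rank u))//= enum_rankK eqxx big1 ?mulr1// => i iu.
by rewrite -(inj_eq enum_rank_inj) enum_valK (negbTE iu) one_profileE.
Qed.

Lemma purify_solution u v w : (u, v, w) \in purify_gates C ->
  (decode z v <> None \/ decode z w <> None) /\
  (forall c : bool, decode z u = Some c -> decode z v = Some c /\ decode z w = Some c).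
Proof.
move=> /gate_of_purify[gv gw].
have {}gv : val_at v = mid_profile (z (enum_rank u) 0).
  by rewrite /val_at gv; exact: separable_single.
have {}gw : val_at w = high_profile (z (enum_rank u) 0).
  by rewrite /val_at gw; exact: separable_single.
split.
  (* At every input one output is exact: mid is 1 from [1 / 2] on, and high is 0 up to [1 / 2]. *)
  case: (lerP (1 / 2) (z (enum_rank u) 0)) => zu.
    by left; rewrite decode_high// gv mid_profile1.
  by right; rewrite decode_low// gw high_profile0// ltW.
case=> [/decode_true zu|/decode_false zu].
  split; apply: decode_high; first by rewrite gv mid_profile1//; lra.
  by rewrite gw high_profile1.
split; apply: decode_low; first by rewrite gv mid_profile0.
by rewrite gw high_profile0//; lra.
Qed.

Lemma oracle_solution (us : N.-tuple V) v : (us, v) \in oracle_gates C ->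
  forall x : N.-tuple bool,
  (forall i, decode z (tnth us i) = Some (tnth x i)) -> decode z v = Some (L x).
Proof.
move=> g x usx; have gv := gate_of_oracle g.
have rx : rounding us z = x.
  apply: eq_from_tnth => k; rewrite tnth_mktuple; have := usx k.
  case: (tnth x k) => [/decode_true|/decode_false] h; first by apply/idP; lra.
  by apply/negbTE; rewrite -leNgt; lra.
have val : val_at v = (L x)%:R.
  (* All coefficients become [L x]; the product for [x] is 1, and any other assignment has a factor
     0 at an input where it differs from [x]. *)
  rewrite /val_at -(gate_field_query C L v) /query gv rx /= /separable.
  rewrite (bigD1 x)//= [X in _ * X]big1 => [|i _]; last first.
    have [ius|nus] := boolP (enum_val i \in us); last first.
      by rewrite /oracle_profile (negbTE nus) one_profileE.
    have [k kE] := tnthP us _ ius.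
    have := usx k; rewrite kE oracle_profile_tnth ?(gate_of_uniq gv)// -kE.
    by case: (tnth x k) => [/decode_true|/decode_false]; rewrite enum_valK => h;
      [exact: high_profile1 | exact: low_profile1].
  rewrite mulr1 big1 ?addr0// => b bx.
  have [k bk] := neq_tuple_tnth bx.
  rewrite (@prod_zero _ (tnth us k)) ?mulr0//= enum_rankK.
  rewrite oracle_profile_tnth ?(gate_of_uniq gv)//; move: (usx k) bk.
  case: (tnth x k) => [/decode_true|/decode_false] h; case: (tnth b k) => // _.
    by apply: low_profile0; lra.
  by apply: high_profile0; lra.
by case: (L x) val => val; [apply: decode_high | apply: decode_low].
Qed.

Lemma decode_solution : opc_solution C L (decode z).
Proof.
split; [exact: nor_solution | exact: purify_solution | exact: oracle_solution].
Qed.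

End Reduction.

Theorem mainTheorem4 (R : realType) :
  exists (red : forall (N : nat) (V : finType) (C : circuit N V),
                  simulator R C)
         (P : program) (c : nat),
  forall (N : nat) (V : finType) (C : circuit N V)
         (L : N.-tuple bool -> bool),
  exists I : smooth_brouwer R #|V|,
    [/\ sb_eps I = 1 / 12%:R,
        Coo_cube (sb_F I),
        (forall z, cube z ->
           [/\ run L (sim_F (red N V C) z) = sb_F I z,
               (num_queries L (sim_F (red N V C) z) <= #|V|)%N,
               run L (sim_J (red N V C) z) = sb_J I z
             & (num_queries L (sim_J (red N V C) z) <= #|V|)%N]),
        (forall z, sb_solution I z ->
           exists b, recovers P c C z b /\ opc_solution C L b)
      & [/\ lipschitz_cube (expR 12%:R * #|V|%:R) (sb_F I),
            smooth_cube (12%:R * expR 24%:R * #|V|%:R ^+ 2) (sb_J I)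
          & forall z (i j : 'I_#|V|), cube z ->
              `|sb_J I z i j| <= expR 12%:R]].
Proof.
exists (fun N V C => reduction R C), recovery, 8 => N V C L.
have tf i : tame (expR 12) (circuit_field (R := R) C L i) by exact: tame_gate_field.
have eps0 : 0 < 1 / 12 :> R by lra.
exists (field_instance tf (expR_ge0 _) eps0); split=> //=.
- exact: field_Coo.
- move=> z _; rewrite run_sim_F run_sim_J !num_queries_ask -cardE.
  by split.
- move=> z [_ /= zfix]; exists (decode z); split; first exact: recovers_decode.
  apply: decode_solution => x; apply: le_trans zfix.
  have := norm_coord_le (field (circuit_field C L) z - z) (enum_rank x).
  by rewrite !mxE /circuit_field enum_rankK.
split.
- exact: field_lipschitz.
- have -> : expR 24 = expR 12 ^+ 2 :> R by rewrite expr2 -expRD; congr expR; lra.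
  exact: jacobian_smooth.
- by move=> z i j _; rewrite mxE; exact: tame_d1.
Qed.
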